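(* Let $G$ be a simple loony endgame with at least two 3-chains. Then the following move in $G$ is optimal: - if $G$ contains a 4-loop, write $G=H+3+4_\ell$; if $cv(H+3)=4$ or $cv(H+4_\ell)=4$ or $cv(H)=4$, open the 4-loop; - in all other cases, open a 3-chain.
   Context: Game. A dots and boxes game (position) $G$ consists of a finite set of unclaimed boxes and a finite set of undrawn lines, each undrawn line bordering either exactly one box or exactly two distinct boxes, each box being bordered by at least one and at most four undrawn lines. Two players play. The player to move draws (removes) an undrawn line; every box none of whose bordering lines is still undrawn is then claimed by that player. If the move claims at least one box the same player must move again (if a line remains); otherwise the other player moves. Claiming a box when possible is not compulsory. The game ends when no line remains. Each player maximises (own boxes) minus (opponent's boxes), counting only boxes claimed from $G$ onwards. Value. $v(G)$ is the net score, under optimal play, of the player who is NOT to move in $G$. Equivalently, $v(G)=0$ if $G$ has no undrawn lines, and otherwise $v(G)=\min_m v(G;m)$ over undrawn lines $m$, where, if drawing $m$ claims $k$ boxes and leaves the position $G_m$, then $v(G;m)=v(G_m)-k$ if $k\ge1$ and $v(G;m)=-v(G_m)$ if $k=0$. A move $m$ is optimal if $v(G;m)=v(G)$. Chains and loops. $G+H$ is the disjoint union. An $n$-chain (denoted $n$) has boxes $b_1,\dots,b_n$ and lines $e_0,\dots,e_n$, where $e_i$ borders $b_i,b_{i+1}$ for $1\le i\le n-1$, $e_0$ borders only $b_1$ and $e_n$ borders only $b_n$. An $n$-loop ($n\ge4$, denoted $n_\ell$) has boxes $b_1,\dots,b_n$ and lines $e_1,\dots,e_n$, $e_i$ bordering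 $b_i,b_{i+1}$ (indices mod $n$). A simple loony endgame is a finite (possibly empty) disjoint union of chains of length at least 3 and loops of even length at least 4. Opening a component $Z$ of it means drawing a line of $Z$; $v(G;Z)$ denotes $v(G;m)$ for any line $m$ of $Z$ (it does not depend on the line). Controlled value. If $G$ is a simple loony endgame with chains of lengths $c_i$ and loops of lengths $\ell_j$, then $fcv(G)=\sum_i(c_i-4)+\sum_j(\ell_j-8)$ and $cv(G)=fcv(G)+tb(G)$, where the terminal bonus $tb(G)$ is: $0$ if $G$ is empty; $4$ if $G$ is non-empty and has a chain of length at least 4 or has no loops; $8$ if $G$ has loops but no chains; $6$ if $G$ has both chains and loops and all its chains are 3-chains. *)

(* Defs.v *)
From HB Require Import structures.
From mathcomp Require Import all_boot all_order all_algebra.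
From mathcomp Require Import zify.

Set Implicit Arguments.
Unset Strict Implicit.
Unset Printing Implicit Defensive.

Import Order.TTheory GRing.Theory Num.Theory.
Local Open Scope ring_scope.

Record game := Game {
  box : finType;
  line : finType;
  borders : line -> {set box}
}.

Definition dots_and_boxes (G : game) : bool :=
  [forall m : line G, (0 < #|borders m| <= 2)%N] &&
  [forall b : box G, (0 < #|[set m : line G | b \in borders m]| <= 4)%N].

(* The positions reachable from [G] are represented by the set [D] of lines
   that are still undrawn; the lines of [G] are all undrawn in [G] itself. *)
Section Play.
Variable G : game.
Implicit Types (D : {set line G}) (m : line G).

Definition unclaimed D : {set box G} :=
  [set b | [exists m in D, b \in borders m]].

Definition claimed D m : {set box G} := unclaimed D :\: unclaimed (D :\ m).

Definition move_value_for (v : {set line G} -> int) D m : int :=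
  if (0 < #|claimed D m|)%N then v (D :\ m) - #|claimed D m|%:Z
  else - v (D :\ m).

(* [n] is fuel. The default element [move_value_for _ D m0] of the iterated
   minimum is one of the values over which the minimum is taken. *)
Fixpoint value_rec (n : nat) D : int :=
  if n is n'.+1 then
    if [pick m in D] is Some m0 then
      \big[Num.min/move_value_for (value_rec n') D m0]_(m in D)
         move_value_for (value_rec n') D m
    else 0
  else 0.

Definition value D : int := value_rec #|D| D.

Definition move_value D m : int := move_value_for value D m.

Lemma value0 : value set0 = 0.
Proof. by rewrite /value cards0. Qed.

Lemma valueS D m0 : m0 \in D ->
  exists2 m1, m1 \in D &
    value D = \big[Num.min/move_value D m1]_(m in D) move_value D m.
Proof.
move=> m0D; rewrite {1}/value (cardsD1 m0) m0D add1n /=.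
case: pickP => [m1 m1D | /(_ m0)]; last by rewrite m0D.
have E m : m \in D ->
  move_value_for (value_rec #|D :\ m0|) D m = move_value D m.
  move=> mD; rewrite /move_value /move_value_for /value.
  suff -> : #|D :\ m0| = #|D :\ m| by [].
  by move: (cardsD1 m0 D) (cardsD1 m D); rewrite m0D mD; lia.
by exists m1 => //; rewrite (E m1 m1D); apply: eq_bigr.
Qed.

Lemma value_le D m : m \in D -> value D <= move_value D m.
Proof.
move=> mD; have [m1 m1D ->] := valueS mD.
by rewrite (bigD1 m) //= ge_min lexx.
Qed.

Lemma value_attained D : D != set0 ->
  exists2 m, m \in D & value D = move_value D m.
Proof.
case/set0Pn=> m0 /valueS[m1 m1D ->].
apply: (big_ind (fun x => exists2 m, m \in D & x = move_value D m)).
- by exists m1.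
- move=> x y [a aD ->] [b bD ->]; rewrite minElt.
  by case: ifP => _; [exists a | exists b].
- by move=> m mD; exists m.
Qed.

End Play.

Definition optimal (G : game) (m : line G) : Prop :=
  move_value [set: line G] m = value [set: line G].

Definition disjoint_union (I : finType) (F : I -> game) : game :=
  @Game {i : I & box (F i)} {i : I & line (F i)}
    (fun m => [set Tagged (fun i => box (F i)) b | b in borders (tagged m)]).

(* Boxes are numbered from 0: [b : 'I_n] stands for b_{b+1}, so that line [i]
   borders the boxes [i.-1] and [i], when they exist. *)
Definition chain_game (n : nat) : game :=
  @Game 'I_n 'I_n.+1
    (fun i => [set b : 'I_n | (b.+1 == i :> nat) || (b == i :> nat)]).

Definition loop_game (n : nat) : game :=
  @Game 'I_n 'I_n (fun i => [set i; ordS i]).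

Inductive component := Chain of nat | Loop of nat.

Definition component_code (c : component) : nat + nat :=
  match c with Chain n => inl n | Loop n => inr n end.
Definition component_decode (x : nat + nat) : component :=
  match x with inl n => Chain n | inr n => Loop n end.
Lemma component_codeK : cancel component_code component_decode.
Proof. by case. Qed.
HB.instance Definition _ :=
  Equality.copy component (can_type component_codeK).

Definition component_game (c : component) : game :=
  match c with Chain n => chain_game n | Loop n => loop_game n end.

Definition simple_loony_component (c : component) : bool :=
  match c with
  | Chain n => (3 <= n)%N
  | Loop n => (4 <= n)%N && ~~ odd n
  end.

(* A simple loony endgame is given by the list of its components; [endgame s]
   is the corresponding position. *)
Definition simple_loony (s : seq component) : bool :=
  all simple_loony_component s.

Definition endgame (s : seq component) : game :=
  disjoint_union (fun i : 'I_(size s) => component_game (tnth (in_tuple s) i)).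

Definition opened (s : seq component) (m : line (endgame s)) : component :=
  tnth (in_tuple s) (tag m).

Definition is_chain (c : component) : bool := if c is Chain _ then true else false.
Definition is_loop (c : component) : bool := if c is Loop _ then true else false.
Definition is_long_chain (c : component) : bool :=
  if c is Chain n then (4 <= n)%N else false.

Definition fcv (s : seq component) : int :=
  \sum_(c <- s) match c with Chain n => n%:Z - 4 | Loop n => n%:Z - 8 end.

(* On simple loony endgames, the last branch is reached exactly when there are
   both chains and loops and all the chains are 3-chains. *)
Definition tb (s : seq component) : int :=
  if s == [::] then 0
  else if has is_long_chain s || ~~ has is_loop s then 4
  else if ~~ has is_chain s then 8
  else 6.

Definition cv (s : seq component) : int := fcv s + tb s.

Definition four_loop_case (s : seq component) : Prop :=
  exists2 H : seq component, perm_eq s (H ++ [:: Chain 3; Loop 4]) &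
    [\/ cv (H ++ [:: Chain 3]) = 4, cv (H ++ [:: Loop 4]) = 4 | cv H = 4].

Lemma chain_dots_and_boxes n : (0 < n)%N -> dots_and_boxes (chain_game n).
Proof.
move=> n0; apply/andP; split; apply/forallP => /= i; apply/andP; split.
- apply/card_gt0P; case: (posnP i) => i0.
    by exists (Ordinal n0); rewrite inE /= i0 eqxx orbT.
  have Hi : (i.-1 < n)%N by have := ltn_ord i; lia.
  by exists (Ordinal Hi); rewrite inE /= prednK ?eqxx.
- have <- : size [:: i.-1; i : nat] = 2%N by [].
  rewrite cardE -(size_map val); apply: uniq_leq_size.
    by rewrite map_inj_uniq ?enum_uniq //; apply: val_inj.
  move=> x /mapP[b]; rewrite mem_enum !inE => /orP[] /eqP <- -> /=;
    by rewrite eqxx ?orbT.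
- by apply/card_gt0P; exists (lift ord0 i); rewrite !inE /= /bump /= add1n eqxx.
- rewrite (_ : [set m | _] = [set lift ord0 i; widen_ord (leqnSn n) i]).
    by rewrite cards2; case: (_ != _).
  by apply/setP=> m; rewrite !inE -!val_eqE /= /bump /= add1n eq_sym [X in _ || X]eq_sym.
Qed.

Lemma loop_dots_and_boxes n : dots_and_boxes (loop_game n).
Proof.
apply/andP; split; apply/forallP => /= i; apply/andP; split.
- by apply/card_gt0P; exists i; rewrite !inE eqxx.
- by rewrite cards2; case: (_ != _).
- by apply/card_gt0P; exists i; rewrite !inE eqxx.
- rewrite (_ : [set m | _] = [set i; ord_pred i]).
    by rewrite cards2; case: (_ != _).
  apply/setP=> m; rewrite !inE eq_sym; congr (_ || _).
  by apply/eqP/eqP => [-> | ->]; rewrite ?ordSK ?ord_predK.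
Qed.

Lemma disjoint_union_dots_and_boxes (I : finType) (F : I -> game) :
  (forall i, dots_and_boxes (F i)) -> dots_and_boxes (disjoint_union F).
Proof.
move=> wfF; apply/andP; split; apply/forallP => /= -[i x].
  have /andP[/forallP/(_ x) H _] := wfF i.
  by rewrite card_imset //; apply: eq_from_Tagged.
have /andP[_ /forallP/(_ x) H] := wfF i.
rewrite (_ : [set m | _] =
  [set Tagged (fun i => line (F i)) m | m in [set m | x \in borders m]]).
  by rewrite card_imset //; apply: eq_from_Tagged.
apply/setP=> m; rewrite inE; apply/imsetP/imsetP.
- case: m => j m /= [b bm E].
  have /= Eij := congr1 tag E.
  subst j; move: (eq_from_Tagged E) => {}E.
  by exists m => //; rewrite inE E.
- by case=> m'; rewrite inE => xm ->; exists x.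
Qed.

Lemma endgame_dots_and_boxes (s : seq component) :
  simple_loony s -> dots_and_boxes (endgame s).
Proof.
move=> /allP wfs; apply: disjoint_union_dots_and_boxes => i.
have := wfs _ (mem_tnth i (in_tuple s)).
case: (tnth _ i) => n /= n3; last exact: loop_dots_and_boxes.
by apply: chain_dots_and_boxes; lia.
Qed.

(* Main.v *)
Require Import Defs.
From HB Require Import structures.
From mathcomp Require Import all_boot all_order all_algebra.
From mathcomp Require Import zify.

(* In a simple loony endgame every box touches exactly two lines, so a component
   is a path or a cycle of lines, consecutive lines sharing a box.  In a position
   reached from it, let T be the number of unclaimed boxes in the partly drawn
   components and V the value of the union of the untouched ones.  The player to
   move can take all T boxes and then open an untouched component, or can keep
   for the end the last two boxes of an opened chain (the last four of an opened
   loop), offer them, and pass the turn.  By induction on the position nothing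
   better exists, so the opening of a component with n boxes is worth
   n + max(-V, V - h), where V is the value of the other components, h = 4 for a
   chain and h = 8 for a loop.

   In the resulting recursion on sets of components, the value is at least the
   controlled value and has the same parity; it equals the controlled value as
   soon as the latter is at least 2, and otherwise is at most 4, or at most 3 when
   there is a 3-chain.  With two 3-chains, the opening of one of them, leaving G',
   can then fail to be optimal only if G or G' has value 0, hence contains a 4-loop
   whose removal leaves the value 4; this value is the controlled value of what
   remains. *)

Set Implicit Arguments.
Unset Strict Implicit.
Unset Printing Implicit Defensive.

Import Order.TTheory GRing.Theory Num.Theory.
Local Open Scope ring_scope.

(** * Unclaimed boxes, captures and offers in an arbitrary game *)

Section Position.
Variable G : game.
Implicit Types (D : {set line G}) (m : line G) (b : box G).

Lemma unclaimedP D b :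
  reflect (exists2 m, m \in D & b \in borders m) (b \in unclaimed D).
Proof. by rewrite inE; apply: (iffP exists_inP). Qed.

Lemma unclaimed_sub D1 D2 : D1 \subset D2 -> unclaimed D1 \subset unclaimed D2.
Proof.
move=> /subsetP sD; apply/subsetP=> b /unclaimedP[m mD mb].
by apply/unclaimedP; exists m => //; apply: sD.
Qed.

Lemma unclaimed0 : unclaimed (set0 : {set line G}) = set0.
Proof. by apply/setP=> b; rewrite !inE; apply/exists_inP => -[m]; rewrite inE. Qed.

Lemma card_unclaimedD1 D m :
  #|unclaimed D| = (#|claimed D m| + #|unclaimed (D :\ m)|)%N.
Proof.
rewrite /claimed (cardsD _ (unclaimed (D :\ m))) addnBAC; last exact/subset_leq_card/subsetIl.
by have /setIidPr -> := unclaimed_sub (subD1set D m); rewrite addnK.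
Qed.

(** A box whose last undrawn line is [m] in the larger position has no other line left in the
    smaller one. Hence a line that takes nothing now took nothing earlier, which lets
    [lower_bound_step] carry such a line back over a capture. *)
Lemma claimed_sub D1 D2 m : D1 \subset D2 -> m \in D1 ->
  claimed D2 m \subset claimed D1 m.
Proof.
move=> sD mD1; apply/subsetP=> b; rewrite in_setD => /andP[bD2 /unclaimedP[m' m'D m'b]].
have bD1 : b \notin unclaimed (D1 :\ m).
  by apply: contra bD2; apply: (subsetP (unclaimed_sub (setSD _ sD))).
rewrite in_setD bD1 /=; apply/unclaimedP; exists m => //.
case: (eqVneq m' m) => [<- //|neq]; case/negP: bD2; apply/unclaimedP.
by exists m' => //; rewrite !inE neq.
Qed.

Lemma move_value_capture D m : claimed D m != set0 ->
  move_value D m = value (D :\ m) - #|claimed D m|%:Z.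
Proof. by rewrite -card_gt0 /move_value /move_value_for => ->. Qed.

Lemma move_value_quiet D m : claimed D m = set0 ->
  move_value D m = - value (D :\ m).
Proof. by rewrite /move_value /move_value_for => ->; rewrite cards0. Qed.

(* The offer [S] at the end of a component: drawing [m] takes nothing and leaves
   all the boxes of [S], [h / 2] in number, to the opponent.  The last field
   lets the player take every other box of the component before offering [S]. *)
Record handout (h : nat) (S : {set line G}) (m : line G) : Prop := Handout {
  handout_in : m \in S;
  handout_quiet : claimed S m = set0;
  handout_card : (2 * #|unclaimed S| = h)%N;
  handout_end : forall l, l \in S :\ m -> claimed (S :\ m) l != set0;
  handout_capture : forall D, S \proper D -> D != [set: line G] ->
    exists2 l, l \in D :\: S & claimed D l != set0
}.

(** What the analysis of a union needs from a component: opening it claims nothing; once opened it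
    offers a capture until exhausted; a line that takes nothing leaves the opponent at least [h / 2]
    boxes; and whichever line [x] opens it, a handout avoiding [x] exists. *)
Record strand (h : nat) : Prop := Strand {
  strand_line : (0 < #|line G|)%N;
  strand_unclaimed : forall m, unclaimed [set~ m] = [set: box G];
  strand_capture : forall D, D != set0 -> D != [set: line G] ->
    exists2 m, m \in D & claimed D m != set0;
  strand_quiet : forall D m, m \in D -> claimed D m = set0 ->
    (h <= 2 * #|unclaimed D|)%N;
  strand_handout : forall x, exists S m, handout h S m /\ x \notin S
}.

End Position.

(** * Values of positions in a disjoint union: taking everything or handing out *)

Section Union.
Variables (I : finType) (F : I -> game) (h : I -> nat).
Hypothesis F_strand : forall i, strand (F i) (h i).

Local Notation G := (disjoint_union F).
Implicit Types (D : {set line G}) (m : line G) (U : {set I}).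

Definition slice D i : {set line (F i)} :=
  [set x | Tagged (fun i => line (F i)) x \in D].

Definition lines U : {set line G} := [set m | tag m \in U].

Definition full D : {set I} := [set i | slice D i == setT].

(** This is T, while V is [value (lines (full D))]. A component drawn completely lies outside
    [full D] but contributes no box. *)
Definition capturable D : nat := (\sum_(i | i \notin full D) #|unclaimed (slice D i)|)%N.

Lemma slice_unclaimed D i (b : box (F i)) :
  (Tagged (fun i => box (F i)) b \in unclaimed D) = (b \in unclaimed (slice D i)).
Proof.
apply/unclaimedP/unclaimedP => [[[j x] xD /= /imsetP[b' b'x E]]|[x]].
  have /= Eij := congr1 tag E; subst j; have {}E := eq_from_Tagged E; subst b'.
  by exists x => //; rewrite inE.
by rewrite inE => xD bx; exists (Tagged (fun i => line (F i)) x) => //=; apply/imset_f.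
Qed.

Lemma sliceD1 D m : slice (D :\ m) (tag m) = slice D (tag m) :\ tagged m.
Proof.
apply/setP=> x; rewrite !inE; congr (~~ _ && _).
by by case: m x => i m x /=; apply/eqP/eqP => [E | -> //]; apply: eq_from_Tagged E.
Qed.

Lemma sliceD1_neq D m i : i != tag m -> slice (D :\ m) i = slice D i.
Proof.
move=> neq; apply/setP=> x; rewrite !inE andb_idl // => _.
by apply: contraNneq neq => <-.
Qed.

Lemma card_claimed D m : #|claimed D m| = #|claimed (slice D (tag m)) (tagged m)|.
Proof.
have tagged_inj i : injective (fun b : box (F i) => Tagged (fun i => box (F i)) b : box G).
  by move=> b1 b2; apply: eq_from_Tagged.
rewrite -(card_imset _ (tagged_inj (tag m))).
apply: eq_card => -[j b]; apply/idP/imsetP => [|[b' b'D ->]]; last first.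
  by move: b'D; rewrite !in_setD !slice_unclaimed sliceD1.
rewrite in_setD !slice_unclaimed; case: (eqVneq j (tag m)) => [E|neq].
  by subst j => bD; exists b => //; rewrite inE -sliceD1.
by rewrite sliceD1_neq // andNb.
Qed.

Lemma slice_lines U i : slice (lines U) i = if i \in U then setT else set0.
Proof. by apply/setP=> x; rewrite !inE /=; case: ifP; rewrite !inE. Qed.

Lemma setT_neq0 i : [set: line (F i)] != set0.
Proof. by rewrite -card_gt0 cardsT (strand_line (F_strand i)). Qed.

Lemma full_lines U : full (lines U) = U.
Proof.
apply/setP=> i; rewrite inE slice_lines; case: ifP => _; first exact: eqxx.
by apply: negbTE; rewrite eq_sym setT_neq0.
Qed.

Lemma capturable_lines U : capturable (lines U) = 0%N.
Proof.
apply: big1 => i; rewrite full_lines slice_lines => /negbTE ->.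
by rewrite unclaimed0 cards0.
Qed.

Lemma lines_full_sub D : lines (full D) \subset D.
Proof.
apply/subsetP=> -[i x]; rewrite !inE /= => /eqP E.
by have := in_setT x; rewrite -E inE.
Qed.

Lemma claimed_eq0 D m :
  (claimed D m == set0) = (claimed (slice D (tag m)) (tagged m) == set0).
Proof. by rewrite -!cards_eq0 card_claimed. Qed.

Lemma full_claimed D m : tag m \in full D -> claimed D m = set0.
Proof.
rewrite inE => /eqP Dm; apply/eqP; rewrite claimed_eq0 Dm /claimed setTD.
by rewrite (strand_unclaimed (F_strand _)) setDT.
Qed.

Lemma fullD1 D m : m \in D -> full (D :\ m) = full D :\ tag m.
Proof.
move=> mD; apply/setP=> i; rewrite !inE; case: (eqVneq i (tag m)) => [->|neq].
  rewrite sliceD1 /=; apply/negbTE/eqP => /setP/(_ (tagged m)).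
  by rewrite !inE eqxx.
by rewrite sliceD1_neq.
Qed.

Lemma fullD1_open D m : m \in D -> tag m \notin full D ->
  full (D :\ m) = full D.
Proof.
move=> mD mU; rewrite fullD1 //; apply/setDidPl.
by rewrite disjoint_sym disjoints1.
Qed.

Lemma capturableD1_open D m : m \in D -> tag m \notin full D ->
  capturable D = (#|claimed D m| + capturable (D :\ m))%N.
Proof.
move=> mD mU; rewrite /capturable fullD1_open //.
rewrite (bigD1 (tag m)) //= (card_unclaimedD1 _ (tagged m)) -card_claimed.
rewrite [in RHS](bigD1 (tag m)) //= sliceD1 addnA; congr (_ + _)%N.
by apply: eq_bigr => i /andP[_ neq]; rewrite sliceD1_neq.
Qed.

Lemma capturableD1_full D m : m \in D -> tag m \in full D ->
  capturable (D :\ m) = (#|box (F (tag m))| + capturable D)%N.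
Proof.
move=> mD mU; rewrite /capturable fullD1 //.
rewrite (bigD1 (tag m)) ?inE ?eqxx //= sliceD1.
move: (mU); rewrite inE => /eqP ->.
rewrite setTD (strand_unclaimed (F_strand _)) cardsT; congr (_ + _)%N.
apply: eq_big => [i|i /andP[_ neq]]; last by rewrite sliceD1_neq.
by rewrite in_setD1; case: (eqVneq i (tag m)) => [->|] /=; rewrite ?andbF ?andbT ?mU.
Qed.

Lemma quiet_capturable D m : m \in D -> tag m \notin full D ->
  claimed D m = set0 -> (h (tag m) <= 2 * capturable D)%N.
Proof.
move=> mD mU /eqP; rewrite claimed_eq0 => /eqP mq.
apply: leq_trans (strand_quiet (F_strand _) _ mq) _.
  by rewrite inE; case: m mD {mU mq}.
by rewrite leq_pmul2l // /capturable (bigD1 (tag m)) //= leq_addr.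
Qed.

Lemma exists_capture D : lines (full D) != D ->
  exists m, [/\ m \in D, tag m \notin full D & claimed D m != set0].
Proof.
move=> nD; have: ~~ (D \subset lines (full D)).
  by apply: contraNN nD => sD; rewrite eqEsubset lines_full_sub.
case/subsetPn=> -[i x] xD; rewrite inE /= => iU.
have [||y] := strand_capture (F_strand i) (D := slice D i).
- by apply/set0Pn; exists x; rewrite inE.
- by move: iU; rewrite inE.
rewrite inE => yD yc; exists (Tagged (fun i => line (F i)) y).
by split; rewrite // claimed_eq0.
Qed.

(* [lower_bound] asks only for a line that takes nothing, which is easier to
   propagate than the existence of a handout required by [handout_bound]; the two
   agree just after a component has been opened. *)
Definition lower_bound D : Prop :=
  value (lines (full D)) <= value D + (capturable D)%:Z \/
  exists m, [/\ m \in D, tag m \notin full D, claimed D m = set0 &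
    (h (tag m))%:Z - value (lines (full D)) <= value D + (capturable D)%:Z].

(** As [value] scores the player not to move, a strategy of the player to move gives an upper bound:
    here, take all T boxes, then move in the untouched part. *)
Definition upper_bound D : Prop :=
  value D + (capturable D)%:Z <= value (lines (full D)).

(** The strategy that offers [S] at the end: its [h i / 2] boxes count twice, being forgone by one
    player and won by the other, who must then move in the untouched part. *)
Definition handout_bound D : Prop :=
  forall i S x, i \notin full D -> handout (h i) S x -> S \subset slice D i ->
  value D + (capturable D)%:Z <= (h i)%:Z - value (lines (full D)).

Lemma capture_value_le D m : m \in D -> tag m \notin full D ->
  claimed D m != set0 ->
  value D + (capturable D)%:Z <= value (D :\ m) + (capturable (D :\ m))%:Z.
Proof.
move=> mD mU mc; have := value_le mD; rewrite move_value_capture //.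
by rewrite (capturableD1_open mD mU); lia.
Qed.

Lemma upper_bound_step D :
  (forall D', (#|D'| < #|D|)%N -> upper_bound D') -> upper_bound D.
Proof.
move=> IH; rewrite /upper_bound.
have [E|/exists_capture[m [mD mU mc]]] := eqVneq (lines (full D)) D.
  by rewrite -{2}E capturable_lines addr0 E.
apply: le_trans (capture_value_le mD mU mc) _.
by rewrite -(fullD1_open mD mU); apply: IH; rewrite [X in (_ < X)%N](cardsD1 m) mD.
Qed.

(** Capture outside [S] as long as possible. When this stops, the touched components are reduced to
    [S], and the handout line is drawn. *)
Lemma handout_bound_step D :
  (forall D', (#|D'| < #|D|)%N -> lower_bound D' /\ handout_bound D') ->
  handout_bound D.
Proof.
move=> IH i S x iU hS sS.
have [/existsP[m /and4P[mD mU mc sSm]]|none] :=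
  boolP [exists m in D, [&& tag m \notin full D, claimed D m != set0 & S \subset slice (D :\ m) i]].
  apply: le_trans (capture_value_le mD mU mc) _; rewrite -(fullD1_open mD mU).
  have [_ hb] := IH (D :\ m) ltac:(by rewrite [X in (_ < X)%N](cardsD1 m) mD).
  by apply: hb hS sSm; rewrite (fullD1_open mD mU).
have Dother j : j != i -> j \notin full D -> slice D j = set0.
  move=> ji jU; apply: contraNeq none => nz.
  move: (jU); rewrite inE => nT.
  have [y yD yc] := strand_capture (F_strand j) nz nT.
  apply/existsP; exists (Tagged (fun i => line (F i)) y); move: yD; rewrite inE => -> /=.
  by rewrite jU claimed_eq0 yc sliceD1_neq // eq_sym.
have Di : slice D i = S.
  apply/eqP; apply: contraNT none => neq; move: (iU); rewrite inE => nT.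
  have [|y] := handout_capture hS _ nT.
    by rewrite properEneq sS eq_sym neq.
  rewrite inE => /andP[yS yD] yc.
  apply/existsP; exists (Tagged (fun i => line (F i)) y); move: (yD); rewrite inE => -> /=.
  rewrite iU claimed_eq0 yc /= (sliceD1 _ (Tagged (fun i => line (F i)) y)) /=.
  by rewrite subsetD1 sS.
pose m := Tagged (fun i => line (F i)) x : line G.
have mD : m \in D.
  by have := handout_in hS; rewrite -Di inE.
have mq : claimed D m = set0.
  by apply/eqP; rewrite claimed_eq0 /= Di (handout_quiet hS).
have TD : capturable D = #|unclaimed S|.
  rewrite /capturable (bigD1 i) //= Di big1 ?addn0 // => j /andP[jU ji].
  by rewrite Dother // unclaimed0 cards0.
have TDm : capturable (D :\ m) = capturable D.
  by rewrite [RHS](capturableD1_open mD) // mq cards0.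
have := value_le mD; rewrite move_value_quiet //.
(* The first alternative of [lower_bound] after the offer is what is needed. The second asks for a
   touched line that takes nothing, and [handout_end] leaves none. *)
have [[lb|[l [lD lU lq _]]] _] := IH (D :\ m) ltac:(by rewrite [X in (_ < X)%N](cardsD1 m) mD).
  move: lb; rewrite fullD1_open // TDm; have := handout_card hS; rewrite TD; lia.
exfalso; rewrite fullD1_open // in lU.
move: (lD) lq; rewrite !inE => /andP[nlm {}lD] /eqP; rewrite claimed_eq0.
case: (eqVneq (tag l) i) => [E|ji]; last first.
  have := Dother _ ji lU; move/setP/(_ (tagged l)); rewrite !inE.
  by case: l lD {nlm lU ji} => ? ? /= ->.
case: l E nlm lD {lU} => j y /= E; subst j => nlm lD.
rewrite (sliceD1 _ m) /= Di; apply/negP; apply: (handout_end hS).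
by rewrite !inE -Di inE lD andbT; apply: contraNneq nlm => ->.
Qed.

Lemma lower_bound_step D :
  (forall D', (#|D'| < #|D|)%N ->
     [/\ lower_bound D', upper_bound D' & handout_bound D']) ->
  lower_bound D.
Proof.
move=> IH; case: (eqVneq D set0) => [D0|/value_attained[m mD vD]].
  left; suff -> : lines (full D) = D by rewrite lerDl.
  by apply/eqP; rewrite D0 -subset0 lines_full_sub.
have ltD : (#|D :\ m| < #|D|)%N by rewrite [X in (_ < X)%N](cardsD1 m) mD.
have [lb ub hb] := IH _ ltD.
case: (boolP (tag m \in full D)) => mU; last first.
  case: (eqVneq (claimed D m) set0) => [mq|mc].
    (* The move is its own witness: the opponent can take all T boxes, and [2 * T] is at least
       [h (tag m)]. *)
    right; exists m; split => //; move: ub; rewrite /upper_bound fullD1_open //.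
    rewrite vD move_value_quiet //; have := quiet_capturable mD mU mq.
    by rewrite (capturableD1_open mD mU) mq cards0 add0n; lia.
  move: lb; rewrite /lower_bound fullD1_open // vD move_value_capture //.
  rewrite (capturableD1_open mD mU) => -[lb|[l [lD lU lq lb]]].
    by left; lia.
  right; exists l; split=> //; [|apply/eqP; rewrite -subset0 -lq|lia].
    by move: lD; rewrite inE => /andP[].
  exact: claimed_sub (subD1set _ _) lD.
have mq := full_claimed mU; rewrite move_value_quiet // in vD.
(* An untouched component is opened while T boxes are on offer. Compare with the same opening in
   [L], where the touched components are gone: whichever alternative bounds the value there, the
   matching strategy in [D :\ m] gives the opponent T boxes more. *)
set L := lines (full D) in lb ub hb *.
have mL : m \in L by rewrite inE.
have fullL : full L = full D by rewrite full_lines.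
have mUL : tag m \in full L by rewrite fullL.
have ltL : (#|L :\ m| < #|D|)%N.
  by apply: leq_ltn_trans ltD; apply/subset_leq_card/setSD/lines_full_sub.
have TD := capturableD1_full mD mU; have TL := capturableD1_full mL mUL.
rewrite capturable_lines addn0 in TL.
have VL : value L <= - value (L :\ m).
  by have := value_le mL; rewrite move_value_quiet // full_claimed.
have UD := fullD1 mD; have UL := fullD1 mL; rewrite fullL in UL.
left; suff: value (D :\ m) + (capturable D)%:Z <= value (L :\ m) by rewrite -/L; lia.
have [[lbL|[l [lL lU lq lbL]]] _ _] := IH _ ltL.
  by move: ub lbL; rewrite /upper_bound UD UL TD TL; lia.
have lm : tag l = tag m.
  move: lL lU; rewrite UL !inE => /andP[_ ->]; rewrite andbT negbK; exact: eqP.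
have [S [x [hS mS]]] := strand_handout (F_strand (tag m)) (tagged m).
have := hb _ _ _ _ hS; rewrite UD !inE eqxx sliceD1 => /(_ isT).
move: (mU); rewrite inE => /eqP ->; rewrite subsetD1 subsetT mS => /(_ isT).
by move: lbL; rewrite UL lm TD TL; lia.
Qed.

Lemma value_bounds D : [/\ lower_bound D, upper_bound D & handout_bound D].
Proof.
have [n] := ubnP #|D|; elim: n D => // n IHn D Dn.
have IH D' : (#|D'| < #|D|)%N -> [/\ lower_bound D', upper_bound D' & handout_bound D'].
  by move=> ltD; apply: IHn; apply: leq_trans ltD _.
split; [exact: lower_bound_step | apply: upper_bound_step | apply: handout_bound_step].
  by move=> D' /IH[].
by move=> D' /IH[].
Qed.

(** Just after the opening both strategies are available, since some handout avoids [tagged m]. Only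
    the component of [m] is touched, so the alternatives of the lower bound meet the two upper
    bounds. *)
Lemma open_value U m : tag m \in U ->
  move_value (lines U) m = #|box (F (tag m))|%:Z +
    Num.max (- value (lines (U :\ tag m)))
            (value (lines (U :\ tag m)) - (h (tag m))%:Z).
Proof.
move=> mU; set L := lines U.
have mL : m \in L by rewrite inE.
have fL : full L = U by rewrite full_lines.
have mUL : tag m \in full L by rewrite fL.
have := fullD1 mL; rewrite fL => fLm.
have TL := capturableD1_full mL mUL.
rewrite capturable_lines addn0 in TL.
have [lb ub hb] := value_bounds (L :\ m).
rewrite move_value_quiet ?full_claimed //.
move: lb ub; rewrite /lower_bound /upper_bound fLm TL => lb ub.
have [S [x [hS mS]]] := strand_handout (F_strand (tag m)) (tagged m).
have := hb _ _ _ _ hS; rewrite fLm !inE eqxx sliceD1 => /(_ isT).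
rewrite slice_lines mU subsetD1 subsetT mS TL => /(_ isT) {}hb.
suff: value (lines (U :\ tag m)) <= value (L :\ m) + #|box (F (tag m))|%:Z \/
   (h (tag m))%:Z - value (lines (U :\ tag m)) <= value (L :\ m) + #|box (F (tag m))|%:Z.
  by lia.
case: lb => [|[l [lL lU lq lb]]]; first by left.
suff E : tag l = tag m by right; rewrite -(congr1 h E).
by move: lL lU; rewrite !inE => /andP[_ ->]; rewrite andbT negbK => /eqP.
Qed.

End Union.

(** * Paths of lines whose consecutive lines share a box *)

Lemma exists_change (p : pred nat) a b i j : (a <= i < b)%N -> (a <= j < b)%N ->
  p i -> ~~ p j -> exists2 k, (a <= k)%N && (k.+1 < b)%N & p k != p k.+1.
Proof.
move=> ai aj pi pj.
have [/hasP[k]|/hasPn no] := boolP (has (fun k => p k != p k.+1) (iota a (b - a).-1)).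
  by rewrite mem_iota => kab pk; exists k => //; lia.
have const k : (a + k < b)%N -> p (a + k)%N = p a.
  elim: k => [|k IHk] kb; first by rewrite addn0.
  rewrite -IHk; last by lia.
  have /no : (a + k)%N \in iota a (b - a).-1 by rewrite mem_iota; lia.
  by rewrite negbK addnS => /eqP.
have constr k : (a <= k < b)%N -> p k = p a.
  by case/andP=> ak kb; rewrite -(subnKC ak) const // subnKC.
by case/negP: pj; rewrite constr // -(constr i).
Qed.

Section Links.
Variable G : game.
Implicit Types (D : {set line G}) (l : line G) (b : box G).

Definition links b l1 l2 :=
  l1 != l2 /\ forall l, (b \in borders l) = (l == l1) || (l == l2).

Lemma links_sym b l1 l2 : links b l1 l2 -> links b l2 l1.
Proof. by case=> neq E; split=> [|l]; [rewrite eq_sym | rewrite E orbC]. Qed.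

Lemma unclaimed_links D b l1 l2 : links b l1 l2 ->
  (b \in unclaimed D) = (l1 \in D) || (l2 \in D).
Proof.
case=> _ bE; apply/unclaimedP/orP => [[l lD]|[] lD].
- by rewrite bE => /orP[] /eqP <-; [left|right].
- by exists l1; rewrite // bE eqxx.
- by exists l2; rewrite // bE eqxx orbT.
Qed.

Lemma claimed_links D b l1 l2 : links b l1 l2 -> l1 \in D -> l2 \notin D ->
  claimed D l1 != set0.
Proof.
move=> bl l1D l2D; apply/set0Pn; exists b.
by rewrite in_setD !(unclaimed_links _ bl) l1D !inE eqxx (negbTE l2D) andbF.
Qed.

Lemma quiet_links D b l1 l2 : links b l1 l2 -> l1 \in D ->
  claimed D l1 = set0 -> l2 \in D.
Proof. by move=> bl l1D /eqP; apply: contraTT; apply: claimed_links bl l1D. Qed.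

(** Between an undrawn and a drawn line some undrawn line is next to a drawn one, and the box they
    share has one line left. The window from [a] to [c] lets the search avoid a handout. *)
Lemma capture_between (f : nat -> line G) (g : nat -> box G) D a c i j :
  (forall k, (a <= k)%N -> (k.+1 < c)%N -> links (g k) (f k) (f k.+1)) ->
  (a <= i < c)%N -> (a <= j < c)%N -> f i \in D -> f j \notin D ->
  exists k, [/\ (a <= k < c)%N, f k \in D & claimed D (f k) != set0].
Proof.
move=> fg ai aj iD jD.
have [k /andP[ak kc]] := exists_change (p := fun k => f k \in D) ai aj iD jD.
have gk := fg k ak kc.
case: (boolP (f k \in D)) => kD; case: (boolP (f k.+1 \in D)) => SkD // _.
  by exists k; split=> //; [lia|apply: claimed_links gk _ _].
by exists k.+1; split=> //; [lia|apply: claimed_links (links_sym gk) _ _].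
Qed.

Lemma card_unclaimed_ge D (r : seq (box G)) : uniq r ->
  {subset r <= unclaimed D} -> (size r <= #|unclaimed D|)%N.
Proof. by move=> ur sr; rewrite cardE uniq_leq_size // => b /sr; rewrite mem_enum. Qed.

Lemma unclaimedC1 l : (forall b, exists l1 l2, links b l1 l2) ->
  unclaimed [set~ l] = [set: box G].
Proof.
move=> bl; apply/setP=> b; have [l1 [l2 bll]] := bl b.
rewrite (unclaimed_links _ bll) !inE -negb_and.
by apply: contra (proj1 bll) => /andP[/eqP-> /eqP->].
Qed.

End Links.

(** * Chains and loops are strands *)

Section ChainStrand.
Variables (K : game) (n : nat) (f : nat -> line K) (g : nat -> box K).
Hypothesis n3 : (3 <= n)%N.
Hypothesis f_eq : forall j k, (j <= n)%N -> (k <= n)%N -> (f j == f k) = (j == k).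
Hypothesis g_eq : forall j k, (j < n)%N -> (k < n)%N -> (g j == g k) = (j == k).
Hypothesis f_onto : forall m, exists2 k, (k <= n)%N & m = f k.
Hypothesis g_onto : forall b, exists2 k, (k < n)%N & b = g k.
Hypothesis fg_links : forall k, (k < n)%N -> links (g k) (f k) (f k.+1).
Implicit Types D : {set line K}.

Let unclaimed_g D k : (k < n)%N -> (g k \in unclaimed D) = (f k \in D) || (f k.+1 \in D).
Proof. by move=> kn; apply: unclaimed_links; apply: fg_links. Qed.

(** The offer is the two boxes at one end: after [f 0] is drawn, [f 1] takes both. Other captures
    are sought from index 2 on, past these two lines. *)
Lemma path_handout : handout 4 [set f 0; f 1] (f 0).
Proof.
split.
- by rewrite !inE eqxx.
- apply/setP=> b; have [k kn ->] := g_onto b.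
  by rewrite in_setD !unclaimed_g // !inE !f_eq //; lia.
- rewrite (_ : unclaimed _ = [set g 0; g 1]); first by rewrite cards2 g_eq //; lia.
  apply/setP=> b; have [k kn ->] := g_onto b.
  by rewrite unclaimed_g // !inE !f_eq ?g_eq //; lia.
- move=> l; rewrite !inE => /andP[l0]; rewrite (negbTE l0) /= => /eqP ->.
  apply: claimed_links (links_sym (fg_links _)) _ _; rewrite ?inE ?eqxx ?f_eq //; lia.
- move=> D /properP[/subsetP sD [l lD lS]] nT.
  have /subsetPn[l' _ l'D] : ~~ ([set: line K] \subset D) by rewrite subTset.
  have [i ni El] := f_onto l; have [j nj El'] := f_onto l'; subst l l'.
  have Sj : f j \notin [set f 0; f 1] by apply: contra l'D => /sD.
  move: lS Sj; rewrite !inE !f_eq //; try lia; move=> i2 j2.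
  have [|||k [kn kD kc]] := capture_between (f := f) (g := g) (a := 2) (c := n.+1) _ _ _ lD l'D.
  + by move=> k _ kn; apply: fg_links.
  + lia.
  + lia.
  by exists (f k) => //; rewrite !inE !f_eq ?kD //; lia.
Qed.

(** As [f k] takes nothing, [f k.+1] is undrawn, and both boxes beside it are unclaimed. The bound
    on [k] makes the second box exist; lines near the other end need the reversed numbering. *)
Lemma path_quiet_low D k : (k < n.-1)%N -> f k \in D -> claimed D (f k) = set0 ->
  (4 <= 2 * #|unclaimed D|)%N.
Proof.
move=> kn kD kq; have SkD : f k.+1 \in D by apply: quiet_links (fg_links _) kD kq; lia.
suff: (size [:: g k; g k.+1] <= #|unclaimed D|)%N by rewrite /=; lia.
apply: card_unclaimed_ge => [|b]; first by rewrite /= inE g_eq; lia.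
by rewrite mem_seq2 => /orP[] /eqP ->; rewrite unclaimed_g ?kD ?SkD //; lia.
Qed.

End ChainStrand.

Lemma chain_strand n : (3 <= n)%N -> strand (chain_game n) 4.
Proof.
move=> n3; set K := chain_game n; have n0 : (0 < n)%N by lia.
pose f k : line K := inord k; pose g k : box K := insubd (Ordinal n0) k.
have val_f k : (k <= n)%N -> f k = k :> nat by move=> kn; rewrite inordK.
have val_g k : (k < n)%N -> g k = k :> nat by move=> kn; rewrite val_insubd kn.
have f_eq j k : (j <= n)%N -> (k <= n)%N -> (f j == f k) = (j == k).
  by move=> jn kn; rewrite -val_eqE /= !val_f.
have g_eq j k : (j < n)%N -> (k < n)%N -> (g j == g k) = (j == k).
  by move=> jn kn; rewrite -val_eqE /= !val_g.
have f_onto m : exists2 k, (k <= n)%N & m = f k.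
  by exists (m : 'I_n.+1); [rewrite -ltnS ltn_ord | rewrite /f inord_val].
have g_onto b : exists2 k, (k < n)%N & b = g k.
  by exists (b : 'I_n); rewrite // /g valKd.
have fg k : (k < n)%N -> links (g k) (f k) (f k.+1).
  move=> kn; split=> [|m]; first by rewrite f_eq; lia.
  have [j jn ->] := f_onto m.
  by rewrite inE !f_eq ?val_f ?val_g //; lia.
(* The numbering from the other end, so that the lemmas about the end at 0 serve both ends. *)
pose f' k := f (n - k)%N; pose g' k := g (n.-1 - k)%N.
have f'_eq j k : (j <= n)%N -> (k <= n)%N -> (f' j == f' k) = (j == k).
  by move=> jn kn; rewrite f_eq; lia.
have g'_eq j k : (j < n)%N -> (k < n)%N -> (g' j == g' k) = (j == k).
  by move=> jn kn; rewrite g_eq; lia.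
have f'_onto m : exists2 k, (k <= n)%N & m = f' k.
  by have [k kn ->] := f_onto m; exists (n - k)%N; rewrite ?leq_subr // /f' subKn.
have g'_onto b : exists2 k, (k < n)%N & b = g' k.
  have [k kn ->] := g_onto b; exists (n.-1 - k)%N; first by lia.
  by rewrite /g' subKn //; lia.
have fg' k : (k < n)%N -> links (g' k) (f' k) (f' k.+1).
  move=> kn; apply: links_sym; rewrite /f' /g'.
  rewrite (_ : n.-1 - k = n - k.+1)%N; last lia.
  by rewrite (_ : n - k = (n - k.+1).+1)%N; [apply: fg|]; lia.
split.
- by rewrite card_ord.
- move=> m; apply: unclaimedC1 => b; have [k kn ->] := g_onto b.
  by exists (f k), (f k.+1); apply: fg.
- move=> D /set0Pn[m mD]; rewrite -subTset => /subsetPn[l _ lD].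
  have [i ni Em] := f_onto m; have [j nj El] := f_onto l; subst m l.
  have [|||k [kn kD kc]] := capture_between (f := f) (g := g) (a := 0) (c := n.+1) _ _ _ mD lD.
  + by move=> k _ kn; apply: fg.
  + lia.
  + lia.
  by exists (f k).
- move=> D m mD mq; have [k kn Em] := f_onto m; subst m.
  case: (ltnP k n.-1) => kn'; first exact: (path_quiet_low n3 g_eq fg kn' mD mq).
  have E : f k = f' (n - k)%N by rewrite /f' subKn.
  by rewrite E in mD mq; apply: (path_quiet_low n3 g'_eq fg' _ mD mq); lia.
- move=> x; have [k kn ->] := f_onto x.
  (* The handout is placed at an end that avoids [x]; since [n >= 3], the lines [n.-1] and [n] have
     index at least 2. *)
  case: (ltnP k 2) => k2.
    exists [set f' 0; f' 1], (f' 0); split.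
      exact: (path_handout n3 f'_eq g'_eq f'_onto g'_onto fg').
    by rewrite !inE !f_eq; lia.
  exists [set f 0; f 1], (f 0); split.
    exact: (path_handout n3 f_eq g_eq f_onto g_onto fg).
  by rewrite !inE !f_eq; lia.
Qed.

Lemma loop_strand n : (4 <= n)%N -> strand (loop_game n) 8.
Proof.
move=> n4; set K := loop_game n; have n0 : (0 < n)%N by lia.
(* Lines and boxes are both numbered cyclically from [x]; box [f x k.+1] lies between lines [f x k]
   and [f x k.+1]. *)
pose f (x : 'I_n) k : 'I_n := Ordinal (ltn_pmod (x + k) n0).
have f_eq x j k : (j < n)%N -> (k < n)%N -> (f x j == f x k) = (j == k).
  by move=> jn kn; rewrite -val_eqE /= eqn_modDl !modn_small.
have f_onto x m : exists2 k, (k < n)%N & m = f x k.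
  exists ((m + n - x) %% n)%N; first exact: ltn_pmod.
  apply: val_inj; rewrite /= modnDmr subnKC; last by have := ltn_ord x; lia.
  by rewrite modnDr modn_small.
have fn x : f x n = f x 0 by apply: val_inj; rewrite /= addn0 modnDr.
have ordS_f x k : ordS (f x k) = f x k.+1.
  by apply: val_inj; rewrite /= -addn1 modnDml addn1 addnS.
have fg x k : links (f x k.+1 : box K) (f x k : line K) (f x k.+1).
  split=> [|m].
    rewrite -val_eqE /= addnS -addn1 -[X in X != _]modn_mod -(modnDml _ 1) .
    have := ltn_pmod (x + k) n0; move: ((x + k) %% n)%N => r rn.
    case: (ltnP r.+1 n) => rn'; first by rewrite !modn_small; lia.
    have -> : (r + 1 = n)%N by lia.
    by rewrite modnn modn_small; lia.
  rewrite inE in_set1 orbC eq_sym -ordS_f inE (inj_eq (can_inj (@ordSK n))).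
  by rewrite eq_sym [X in _ || X]eq_sym.
have un x D k : (f x k.+1 \in unclaimed (D : {set line K})) = (f x k \in D) || (f x k.+1 \in D).
  exact: unclaimed_links.
have f0 x : f x 0 = x by apply: val_inj; rewrite /= addn0 modn_small.
have f_ontoS x m : exists2 k, (k < n)%N & m = f x k.+1.
  by have [k kn E] := f_onto x (ord_pred m); exists k; rewrite // -ordS_f -E ord_predK.
have f_eqS x j k : (j < n)%N -> (k < n)%N -> (f x j.+1 == f x k.+1) = (j == k).
  by move=> jn kn; rewrite -!ordS_f (inj_eq (can_inj (@ordSK n))) f_eq.
have f_eqT x j k : (0 < j < n)%N -> (k <= n)%N -> (f x k == f x j) = (k == j).
  move=> jn; rewrite leq_eqVlt => /orP[/eqP ->|kn]; last by rewrite f_eq //; lia.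
  by rewrite fn f_eq //; lia.
split.
- by rewrite card_ord.
- move=> m; apply: unclaimedC1 => b; have [k kn ->] := f_ontoS m b.
  by exists (f m k), (f m k.+1); apply: fg.
- move=> D /set0Pn[m mD]; rewrite -subTset => /subsetPn[l _ lD].
  have [j nj El] := f_onto m l; subst l.
  rewrite -[m](f0 m) in mD.
  have [|||k [kn kD kc]] := @capture_between K (f m) (fun k => f m k.+1) D 0 n _ _ _ _ _ mD lD.
  + by move=> k _ kn; apply: fg.
  + lia.
  + lia.
  by exists (f m k).
(* With [m] written as [f x 1], both neighbours are undrawn, and the three lines touch four boxes,
   distinct because [n >= 4]. *)
- move=> D m; rewrite -[m]ord_predK -[ord_pred m]f0 ordS_f.
  move: (ord_pred m) => x mD mq.
  have xD : f x 0 \in D by apply: quiet_links (links_sym (fg x 0)) mD mq.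
  have x2D : f x 2 \in D by apply: quiet_links (fg x 1) mD mq.
  suff: (size [:: f x 0; f x 1; f x 2; f x 3] <= #|unclaimed D|)%N by rewrite /=; lia.
  apply: (@card_unclaimed_ge K) => [|b]; first by rewrite /= !inE !f_eq //; lia.
  rewrite mem_seq4 => /or4P[] /eqP ->; rewrite ?un ?xD ?mD ?x2D ?orbT //.
  by rewrite -fn -(prednK n0) un (prednK n0) fn xD orbT.
(* Three consecutive lines touch four boxes; drawing the middle one leaves two lines that take two
   boxes each. *)
- move=> x; pose S : {set line K} := [set f x 1; f x 2; f x 3].
  have inS k : (k <= n)%N -> (f x k \in S) = (0 < k < 4)%N.
    by move=> kn; rewrite !inE !f_eqT //; lia.
  have inSD k : (k <= n)%N -> (f x k \in S :\ f x 2) = (k == 1)%N || (k == 3)%N.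
    by move=> kn; rewrite in_setD1 inS // f_eqT //; lia.
  exists S, (f x 2); split; last by rewrite -[x in x \notin _](f0 x) inS.
  split.
  + by rewrite inS //; lia.
  + apply/setP=> b; have [k kn ->] := f_ontoS x b.
    by rewrite in_setD [RHS]inE !un !inS ?inSD //; lia.
  + have uS : uniq [:: f x 1; f x 2; f x 3; f x 4].
      by rewrite /= !inE !f_eqS //; lia.
    rewrite (_ : #|_| = 4) //; rewrite -[RHS](card_uniqP uS); apply: eq_card => b.
    have [k kn ->] := f_ontoS x b.
    by rewrite un mem_seq4 !f_eqS ?inS //; lia.
  + move=> l; have [k kn ->] := f_ontoS x l; rewrite inSD // => kS.
    have {kS} [->|->] : (k = 0 \/ k = 2)%N by lia.
      by apply: claimed_links (fg x 1) _ _; rewrite inSD //; lia.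
    by apply: claimed_links (links_sym (fg x 2)) _ _; rewrite inSD //; lia.
  + move=> D /properP[/subsetP sD [l lD lS]] nT.
    have /subsetPn[l' _ l'D] : ~~ ([set: line K] \subset D) by rewrite subTset.
    have [i ni El] := f_ontoS x l; have [j nj El'] := f_ontoS x l'; subst l l'.
    have Sj : f x j.+1 \notin S by apply: contra l'D => /sD.
    rewrite !inS // in lS Sj.
    (* Lines are indexed from 1 to [n], with [x] at index [n], so that the lines outside [S] form
       the path from 4 to [n] without wrapping around. *)
    have [|||k [kn kD kc]] :=
      @capture_between K (f x) (fun k => f x k.+1) D 4 n.+1 _ _ _ _ _ lD l'D.
    * by move=> k _ kn; apply: fg.
    * lia.
    * lia.
    by exists (f x k) => //; rewrite in_setD inS ?kD //; lia.
Qed.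

(** * The recursion on sets of components and the controlled value *)

Definition open_cost (z : component) (x : int) : int :=
  match z with
  | Chain n => n%:Z + Num.max (- x) (x - 4)
  | Loop n => n%:Z + Num.max (- x) (x - 8)
  end.

Definition weight (z : component) : int :=
  match z with Chain n => n%:Z - 4 | Loop n => n%:Z - 8 end.

Section Endgame.
Variables (I : finType) (c : I -> component) (V : {set I} -> int).
Hypothesis c_loony : forall i, simple_loony_component (c i).
Hypothesis V0 : V set0 = 0.
Hypothesis V_le : forall (U : {set I}) i, i \in U -> V U <= open_cost (c i) (V (U :\ i)).
Hypothesis V_attained : forall U : {set I}, U != set0 ->
  exists2 i, i \in U & V U = open_cost (c i) (V (U :\ i)).
Implicit Types (U : {set I}) (p : pred component).

Definition has_comp p U := [exists i in U, p (c i)].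

Definition fcv_set U : int := \sum_(i in U) weight (c i).

Definition tb_set U : int :=
  if has_comp is_long_chain U then 4
  else if has_comp is_loop U then (if has_comp is_chain U then 6 else 8)
  else if has_comp is_chain U then 4 else 0.

Definition cv_set U : int := fcv_set U + tb_set U.

Lemma has_compD1 p U i : i \in U -> has_comp p U = p (c i) || has_comp p (U :\ i).
Proof.
move=> iU; apply/exists_inP/orP => [[j jU pj]|[pi|/exists_inP[j]]].
- case: (eqVneq j i) => [<-|ji]; [by left | right].
  by apply/exists_inP; exists j; rewrite // !inE ji.
- by exists i.
- by rewrite inE => /andP[_ jU] pj; exists j.
Qed.

Lemma has_compT p U i : i \in U -> p (c i) -> has_comp p U.
Proof. by move=> iU pi; apply/exists_inP; exists i. Qed.

Lemma has_comp_eq0 U : (U == set0) = ~~ (has_comp is_loop U || has_comp is_chain U).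
Proof.
apply/eqP/idP => [->|].
  by rewrite /has_comp negb_or; apply/andP; split; apply/exists_inP => -[i]; rewrite inE.
apply: contraNeq => /set0Pn[i iU]; case E: (c i) => [n|n].
  by rewrite (has_compT (i := i) (p := is_chain)) ?E // orbT.
by rewrite (has_compT (i := i) (p := is_loop)) ?E.
Qed.

Lemma long_is_chain U : has_comp is_long_chain U -> has_comp is_chain U.
Proof. by case/exists_inP=> i iU il; apply: has_compT iU _; case: (c i) il. Qed.

Lemma chain_long U i : ~~ has_comp (pred1 (Chain 3)) U -> i \in U ->
  is_chain (c i) -> is_long_chain (c i).
Proof.
move=> no3 iU; have := c_loony i.
have : c i != Chain 3.
  by apply: contraNneq no3 => ci; apply: has_compT iU _; rewrite /= ci.
case: (c i) => // n /eqP n3 /= ? _.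
by rewrite ltnNge; apply/negP => ?; case: n3; congr Chain; lia.
Qed.

Lemma has_chain_long U (W : {set I}) : ~~ has_comp (pred1 (Chain 3)) U ->
  W \subset U -> has_comp is_chain W = has_comp is_long_chain W.
Proof.
move=> no3 /subsetP WU; apply/idP/idP; last exact: long_is_chain.
by case/exists_inP=> i iW /(chain_long no3 (WU _ iW)); apply: has_compT.
Qed.

Lemma fcv_setD1 U i : i \in U -> fcv_set U = weight (c i) + fcv_set (U :\ i).
Proof. exact: big_setD1. Qed.

Lemma fcv_set_ge0 U : (forall i, i \in U -> 0 <= weight (c i)) -> 0 <= fcv_set U.
Proof. exact: sumr_ge0. Qed.

Lemma fcv_set0 : fcv_set set0 = 0.
Proof. exact: big_set0. Qed.

Lemma only_3chains U i : ~~ has_comp is_long_chain U -> ~~ has_comp is_loop U ->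
  i \in U -> c i = Chain 3.
Proof.
move=> /exists_inP nl /exists_inP np iU; have := c_loony i.
case E: (c i) => [n|n] /= n3; last by case: np; exists i; rewrite ?E.
suff: ~~ (4 <= n)%N by move=> n4; congr Chain; lia.
by apply/negP=> n4; case: nl; exists i; rewrite ?E.
Qed.

Lemma fcv_only_3chains U : ~~ has_comp is_long_chain U -> ~~ has_comp is_loop U ->
  fcv_set U = - #|U|%:Z.
Proof.
move=> nl np; rewrite /fcv_set (eq_bigr (fun=> -1)) => [|i iU].
  by rewrite sumr_const mulNrn natz.
by rewrite (only_3chains nl np iU).
Qed.

Lemma set_D1_ind (P : {set I} -> Prop) :
  (forall U, (forall i, i \in U -> P (U :\ i)) -> P U) -> forall U, P U.
Proof.
move=> step U; have [n] := ubnP #|U|; elim: n U => // n IHn U Un.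
by apply: step => i iU; apply: IHn; move: Un; rewrite (cardsD1 i) iU.
Qed.

(** The terms [- x] and [x - h] add up to [- h], so their maximum is at least [- h / 2], and a
    component has at least [h / 2] boxes. *)
Lemma open_cost_ge0 i x : 0 <= open_cost (c i) x.
Proof. by have := c_loony i; case: (c i) => n /=; lia. Qed.

Lemma V_ge0 U : 0 <= V U.
Proof.
have [->|/V_attained[i _ ->]] := eqVneq U set0; first by rewrite V0.
exact: open_cost_ge0.
Qed.

Lemma V_parity U : exists k : int, V U = fcv_set U + 2 * k.
Proof.
elim/set_D1_ind: U => U IH; have [->|/V_attained[i iU ->]] := eqVneq U set0.
  by exists 0; rewrite V0 fcv_set0.
have [k ->] := IH i iU; rewrite (fcv_setD1 iU).
move: (fcv_set _) => f; case: (c i) => n /=.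
  have [|] := leP (- (f + 2 * k)) (f + 2 * k - 4) => _.
    by exists k; lia.
  by exists (2 - f - k); lia.
have [|] := leP (- (f + 2 * k)) (f + 2 * k - 8) => _.
  by exists k; lia.
by exists (4 - f - k); lia.
Qed.

Lemma V_cv_parity U : exists k : int, V U = cv_set U + 2 * k.
Proof.
have [k ->] := V_parity U; rewrite /cv_set /tb_set.
by do ![case: ifP => _];
  [exists (k - 2) | exists (k - 3) | exists (k - 4) | exists (k - 2) | exists k]; lia.
Qed.

Lemma V_only_3chains U : ~~ has_comp is_long_chain U -> ~~ has_comp is_loop U ->
  V U <= 3.
Proof.
elim/set_D1_ind: U => U IH nl np.
have [->|/set0Pn[i iU]] := eqVneq U set0; first by rewrite V0.
have := V_le iU; have := IH i iU; have := V_ge0 (U :\ i).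
move: (nl) (np); rewrite !(has_compD1 _ iU) (only_3chains nl np iU) /= => nl' np'.
by move=> ge0 /(_ nl' np'); lia.
Qed.

(** The alternative [x - h] of an optimal opening suffices unless the opening lowers [tb_set]. That
    happens only if nothing remains, or if the last loop is opened and only 3-chains remain; then
    the alternative [- x] suffices, by [V_only_3chains]. *)
Lemma cv_le_V U : cv_set U <= V U.
Proof.
elim/set_D1_ind: U => U IH; have [->|/V_attained[i iU ->]] := eqVneq U set0.
  rewrite V0 /cv_set fcv_set0 /tb_set.
  have := has_comp_eq0 set0; have := @long_is_chain set0; rewrite eqxx.
  by do 3!case: has_comp => //=; move=> /(_ isT).
have := IH i iU; have := c_loony i; have := has_comp_eq0 (U :\ i).
have := @V_only_3chains (U :\ i); have := @fcv_only_3chains (U :\ i).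
have := @long_is_chain (U :\ i).
have V0' : (U :\ i) == set0 -> V (U :\ i) = 0 /\ fcv_set (U :\ i) = 0.
  by move/eqP=> ->; rewrite V0 fcv_set0.
have card0 : (U :\ i) == set0 \/ (0 < #|U :\ i|)%N.
  by case: eqVneq; [left | right; rewrite card_gt0].
move: V0' card0; rewrite /cv_set /tb_set !(has_compD1 _ iU) (fcv_setD1 iU).
move: #|_| (V _) (fcv_set _) (_ == _) => N x f e.
case: (has_comp is_long_chain _); case: (has_comp is_loop _);
  case: (has_comp is_chain _); case: (c i) => n; rewrite /= ?orbT ?orbF /=; try case: ifP => ?; lia.
Qed.

(** By [cv_le_V], one opening of cost at most [cv_set U] is enough. An opening that keeps [tb_set]
    has cost [cv_set U] when the rest has its controlled value as value and this is at least
    [h / 2]. *)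
Lemma V_eq_cv U : 2 <= cv_set U -> V U = cv_set U.
Proof.
elim/set_D1_ind: U => U IH cv2; apply/eqP; rewrite eq_le cv_le_V andbT.
have VD i : i \in U -> 2 <= cv_set (U :\ i) -> V (U :\ i) = cv_set (U :\ i) by exact: IH.
have V_empty i : U :\ i == set0 -> V (U :\ i) = 0 /\ fcv_set (U :\ i) = 0.
  by move/eqP=> ->; rewrite V0 fcv_set0.
have [/exists_inP[l lU ll]|noloop] := boolP (has_comp is_loop U); last first.
  have : exists2 i, i \in U & (c i == Chain 3) || (0 <= fcv_set (U :\ i)).
    have [/exists_inP[i iU ci]|no3] := boolP (has_comp (pred1 (Chain 3)) U).
      by exists i => //; apply/orP; left.
    have /set0Pn[i iU] : U != set0.
      apply: contraTneq cv2 => U0; have := has_comp_eq0 U; rewrite /cv_set /tb_set U0 fcv_set0.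
      have := @long_is_chain set0; rewrite eqxx.
      by do 3!case: has_comp => //=; move=> /(_ isT).
    exists i => //; rewrite fcv_set_ge0 ?orbT // => j; rewrite inE => /andP[_ jU].
    have := chain_long no3 jU.
    case E: (c j) => [n|n] /= => [/(_ isT)|_]; first by lia.
    by case/negP: noloop; apply: has_compT jU _; rewrite E.
  case=> i iU; have := V_le iU; have := VD i iU; have := has_comp_eq0 (U :\ i).
  have := V_empty i; have := @long_is_chain (U :\ i); have := c_loony i.
  move: noloop cv2; rewrite /cv_set /tb_set !(has_compD1 _ iU) (fcv_setD1 iU).
  rewrite negb_or => /andP[nl /negbTE ->].
  case E: (c i) nl => [n|n] //= _.
  have -> : (Chain n == Chain 3) = (n == 3) by apply/eqP/eqP => [[]|->].
  case: (has_comp is_long_chain (U :\ i)); case: (has_comp is_chain (U :\ i));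
    rewrite /= ?orbT ?orbF; move: (V (U :\ i)) (V U) (fcv_set (U :\ i)) (_ == set0) => x y f e;
    try case: ifP => ?; lia.
have [/exists_inP[i iU /andP[/eqP ci hi]]|no_i] := boolP [exists i in U,
    (c i == Chain 3) && (has_comp is_long_chain U || has_comp is_chain (U :\ i))].
  have := V_le iU; have := VD i iU.
  have : has_comp is_loop U by apply: has_compT lU ll.
  have := @long_is_chain (U :\ i).
  move: hi cv2; rewrite /cv_set /tb_set !(has_compD1 _ iU) (fcv_setD1 iU) ci /=.
  case: (has_comp is_long_chain (U :\ i)); case: (has_comp is_loop (U :\ i));
    case: (has_comp is_chain (U :\ i)) => //=; lia.
(* No 3-chain can be opened at constant [tb]: open a smallest loop instead. *)
pose len i := if c i is Loop n then n else 0%N.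
have P0 : (l \in U) && is_loop (c l) by rewrite lU.
case: (@arg_minnP _ l (fun i => (i \in U) && is_loop (c i)) len P0) => i /andP[iU li] imin.
have loop_ge j : j \in U -> is_loop (c j) -> (8 <= len i)%N -> 0 <= weight (c j).
  by move=> jU lj; have := imin j; rewrite jU lj /len => /(_ isT); case: (c j) lj => //=; lia.
have := V_le iU; have := VD i iU; have := has_comp_eq0 (U :\ i); have := V_empty i.
have := c_loony i; move: li loop_ge; rewrite /len.
case ci: (c i) => [//|n] _ loop_ge.
have [/exists_inP[j jU /eqP cj]|no3] := boolP (has_comp (pred1 (Chain 3)) U); last first.
  (* A smallest loop of length 4 or 6 has negative weight, so removing it raises [fcv_set]; from
     length 8 on, no remaining weight is negative. *)
  have : (8 <= n)%N -> 0 <= fcv_set (U :\ i).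
    move=> n8; apply: fcv_set_ge0 => j; rewrite inE => /andP[_ jU].
    have := chain_long no3 jU; have := loop_ge j jU.
    by case: (c j) => m /=; [move=> _ /(_ isT) | move=> /(_ isT n8)]; lia.
  move: cv2; rewrite /cv_set /tb_set -!(has_chain_long no3) ?subsetDl //.
  rewrite !(has_compD1 _ iU) (fcv_setD1 iU) ci.
  case: (has_comp is_loop (U :\ i)); case: (has_comp is_chain (U :\ i)) => //=;
    move: (V (U :\ i)) (V U) (fcv_set (U :\ i)) (_ == set0) => x y f e; lia.
have ji : j != i by apply/eqP => E; rewrite E ci in cj.
have jUi : j \in U :\ i by rewrite !inE ji.
have iUj : i \in U :\ j by rewrite !inE eq_sym ji.
(* By the failed search, [j] is the only chain; all other components are loops. *)
have /norP[nl nch] : ~~ (has_comp is_long_chain U || has_comp is_chain (U :\ j)).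
  by apply: contraNN no_i => hj; apply/exists_inP; exists j; rewrite // cj eqxx.
have fcv_ge : (8 <= n)%N -> 0 <= fcv_set (U :\ i :\ j).
  move=> n8; apply: fcv_set_ge0 => k; rewrite !inE => /and3P[kj _ kU].
  apply: loop_ge => //; case ck: (c k) => [m|] //; case/negP: nch.
  by apply: (@has_compT _ _ k); rewrite ?inE ?kj ?ck.
have Z0 := has_comp_eq0 (U :\ i :\ j).
have fZ : U :\ i :\ j == set0 -> fcv_set (U :\ i :\ j) = 0 by move/eqP->; apply: fcv_set0.
have UU : U :\ j :\ i = U :\ i :\ j by rewrite !setDDl setUC.
move: cv2 nl nch Z0; rewrite (has_compD1 _ iUj) UU /cv_set /tb_set.
rewrite !(has_compD1 _ iU) !(has_compD1 _ jUi) (fcv_setD1 iU) (fcv_setD1 jUi) ci cj /=.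
move: fZ fcv_ge; move: (fcv_set _) (V _) (V U) => f x y; move: (_ == set0) (_ == set0) => e e'.
case: (has_comp is_long_chain _) => //; case: (has_comp is_chain _) => //.
by case: (has_comp is_loop _) => /=; lia.
Qed.

(** Open a 3-chain, else a 4-loop, else a 6-loop: the value of the rest is small enough for the cost
    to respect the bound. If none exists, all weights are nonnegative, so [cv_set U >= 4] unless [U]
    is empty. *)
Lemma V_le4 U : cv_set U < 2 ->
  V U <= 4 /\ (has_comp (pred1 (Chain 3)) U -> V U <= 3).
Proof.
elim/set_D1_ind: U => U IH cv2.
have V4 i : i \in U -> cv_set (U :\ i) <= 4 -> V (U :\ i) <= 4.
  move=> iU cv4; have [/(IH i iU)[]//|cv2'] := ltP (cv_set (U :\ i)) 2.
  by rewrite V_eq_cv.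
have [h3|no3] := boolP (has_comp (pred1 (Chain 3)) U).
  suff V3 : V U <= 3 by split=> //; apply: le_trans V3 _.
  case/exists_inP: h3 => i iU /eqP ci.
  have := V_le iU; have := V_ge0 (U :\ i); have := V4 i iU.
  move: cv2; rewrite /cv_set /tb_set !(has_compD1 _ iU) (fcv_setD1 iU) ci /=.
  move: (V _) (V U) (fcv_set _) => x y f.
  case: (has_comp is_long_chain (U :\ i)); case: (has_comp is_loop (U :\ i));
    case: (has_comp is_chain (U :\ i)) => /=; lia.
split=> //.
have ne3 i : i \in U -> c i != Chain 3.
  by move=> iU; apply: contraNneq no3 => ci; apply: has_compT iU _; rewrite /= ci.
have tbU (W : {set I}) : W \subset U -> tb_set W =
    if has_comp is_chain W then 4 else if has_comp is_loop W then 8 else 0.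
  by move=> WU; rewrite /tb_set -(has_chain_long no3) //; case: (has_comp is_chain W).
have [/exists_inP[i iU /eqP ci]|no4] := boolP (has_comp (pred1 (Loop 4)) U).
  have := V_le iU; have := V_ge0 (U :\ i).
  have : V (U :\ i) <= 5.
    have cv5 : cv_set (U :\ i) <= 5.
      move: cv2; rewrite /cv_set !tbU ?subsetDl // !(has_compD1 _ iU) (fcv_setD1 iU) ci /=.
      move: (fcv_set _) => f.
      case: (has_comp is_loop (U :\ i)); case: (has_comp is_chain (U :\ i)) => /=; lia.
    have [/(IH i iU)[le4 _]|cv2'] := ltP (cv_set (U :\ i)) 2; first by lia.
    by rewrite V_eq_cv.
  by rewrite ci /=; lia.
have ne4 i : i \in U -> c i != Loop 4.
  by move=> iU; apply: contraNneq no4 => ci; apply: has_compT iU _; rewrite /= ci.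
have [/exists_inP[i iU /eqP ci]|no6] := boolP (has_comp (pred1 (Loop 6)) U).
  have cvD : cv_set (U :\ i) <= 3 /\ U :\ i != set0.
    rewrite has_comp_eq0.
    move: cv2; rewrite /cv_set !tbU ?subsetDl // !(has_compD1 _ iU) (fcv_setD1 iU) ci /=.
    have := @fcv_set0; have := has_comp_eq0 (U :\ i); case: eqVneq => [->|_].
      by move=> /esym; rewrite negb_or => /andP[/negbTE -> /negbTE ->] ->.
    move: (fcv_set _) => f.
    case: (has_comp is_loop (U :\ i)); case: (has_comp is_chain (U :\ i)) => //= _; lia.
  case: cvD => cv3 ne0; have le4 := V4 i iU (le_trans cv3 (isT : 3 <= 4 :> int)).
  have [j] := V_attained ne0; rewrite inE => /andP[_ jU] Vj.
  (* The cost 6 - x of the 6-loop is at most 4 only if x is at least 2. The rest has neither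
     3-chains nor 4-loops, so each of its openings costs at least 2. *)
  have ge2 : 2 <= V (U :\ i).
    rewrite Vj; have := ne3 j jU; have := ne4 j jU; have := c_loony j.
    case: (c j) => n /=.
      by move=> ? _ /eqP n3; have ? : n <> 3%N by [move=> ?; case: n3; congr Chain]; lia.
    by move=> ? /eqP n4; have ? : n <> 4%N by [move=> ?; case: n4; congr Loop]; lia.
  by have := V_le iU; rewrite ci /=; lia.
have [->|ne0] := eqVneq U set0; first by rewrite V0.
have fcv0 : 0 <= fcv_set U.
  apply: fcv_set_ge0 => i iU; have := chain_long no3 iU; have := ne4 i iU; have := c_loony i.
  have : c i != Loop 6.
    by apply: contraNneq no6 => ci; apply: has_compT iU _; rewrite /= ci.
  case: (c i) => n /=; first by move=> _ _ _ /(_ isT); lia.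
  move=> /eqP n6 n4e /eqP n4 _.
  have ? : n <> 6%N by move=> ?; case: n6; congr Loop.
  have ? : n <> 4%N by move=> ?; case: n4; congr Loop.
  lia.
move: ne0 cv2; rewrite has_comp_eq0 /cv_set tbU //.
by case: (has_comp is_loop U); case: (has_comp is_chain U) => //= _; lia.
Qed.

(** An opening costs at least [n - h / 2], which vanishes only for a 4-loop, and then the maximum
    must be attained at x = 4. *)
Lemma V_eq0 U : U != set0 -> V U = 0 ->
  exists i, [/\ i \in U, c i = Loop 4 & V (U :\ i) = 4].
Proof.
move=> /V_attained[i iU ->] V0i; exists i; move: V0i; have := c_loony i.
case: (c i) => n /= hn; first by lia.
move=> V0i; suff n4 : n = 4%N by split; rewrite ?n4 //; lia.
by lia.
Qed.

(** A 3-chain excludes the value 4 when [cv_set U < 2], by [V_le4]; otherwise [V_eq_cv] applies. *)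
Lemma V_eq4 U j : j \in U -> c j = Chain 3 -> cv_set U <= 4 -> V U = 4 ->
  cv_set U = 4.
Proof.
move=> jU cj cv4 V4; have [lt2|ge2] := ltP (cv_set U) 2; last by rewrite -V4 V_eq_cv.
have [_ /(_ (has_compT jU _))] := V_le4 lt2.
by rewrite cj V4 => /(_ (eqxx _)).
Qed.

Lemma cv_open_3chain U j k : j \in U -> c j = Chain 3 -> k \in U -> c k = Chain 3 ->
  k != j -> cv_set (U :\ j) = cv_set U + 1.
Proof.
move=> jU cj kU ck kj; have kUj : k \in U :\ j by rewrite !inE kj.
rewrite /cv_set /tb_set (fcv_setD1 jU) !(has_compD1 _ jU) cj /= (has_compD1 is_chain kUj) ck /=.
case: (has_comp is_long_chain (U :\ j)); case: (has_comp is_loop (U :\ j)) => /=; lia.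
Qed.

(** The loop has weight -4, and [tb_set] changes only when the rest consists of 3-chains, dropping
    from 6 to 4. *)
Lemma cv_open_4loop U i k : i \in U -> c i = Loop 4 -> k \in U -> c k = Chain 3 ->
  cv_set (U :\ i) <= cv_set U + 4 /\
  (has_comp is_long_chain (U :\ i) || has_comp is_loop (U :\ i) ->
   cv_set (U :\ i) = cv_set U + 4).
Proof.
move=> iU ci kU ck; have kUi : k \in U :\ i.
  by rewrite !inE kU andbT; apply/eqP => E; rewrite -E ck in ci.
rewrite /cv_set /tb_set (fcv_setD1 iU) !(has_compD1 _ iU) ci /= (has_compD1 is_chain kUi) ck /=.
case: (has_comp is_long_chain (U :\ i)); case: (has_comp is_loop (U :\ i)) => /=; lia.
Qed.

(** In the three cases the rest has value 4, 7 or 3, and the 4-loop costs 0, 3 or 1. These are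
    optimal because values are nonnegative, because [cv_set U = 3], and because the value is odd,
    respectively. *)
Lemma open_4loop_optimal U i j k : i \in U -> c i = Loop 4 ->
  j \in U -> c j = Chain 3 -> k \in U -> c k = Chain 3 -> k != j ->
  [\/ cv_set (U :\ i) = 4, cv_set (U :\ j) = 4 | cv_set (U :\ i :\ j) = 4] ->
  open_cost (c i) (V (U :\ i)) = V U.
Proof.
move=> iU ci jU cj kU ck kj; have := V_le iU; rewrite ci /= => VU.
have ki : k != i by apply/eqP => E; rewrite -E ck in ci.
have ji : j != i by apply/eqP => E; rewrite -E cj in ci.
have jUi : j \in U :\ i by rewrite !inE ji.
have kUi : k \in U :\ i by rewrite !inE ki.
have cvj := cv_open_3chain jU cj kU ck kj.
have cvij := cv_open_3chain jUi cj kUi ck kj.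
have [_ cvi] := cv_open_4loop iU ci kU ck.
have only : has_comp is_long_chain (U :\ i) || has_comp is_loop (U :\ i) \/
    cv_set (U :\ i) < 3 /\ cv_set U < 3.
  have [|/norP[nl np]] := boolP (_ || _); [by left | right].
  have := fcv_only_3chains nl np; rewrite (cardsD1 j) jUi (cardsD1 k) !inE kj ki kU.
  rewrite /cv_set /tb_set (fcv_setD1 iU) !(has_compD1 _ iU) ci (negbTE nl) (negbTE np).
  by rewrite (has_compD1 is_chain kUi) ck /=; lia.
have [k' kE] := V_cv_parity U; have U0 := V_ge0 U.
case=> cv4.
- by move: VU; rewrite [V (U :\ i)]V_eq_cv cv4 //; lia.
- have E : cv_set U = 3 by lia.
  rewrite [V U]V_eq_cv E //; case: only => [/cvi E'|[_]]; last by rewrite E.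
  by rewrite V_eq_cv E' E.
- case: only => [/cvi E'|[lt3 _]]; last by lia.
  move: VU; rewrite [V (U :\ i)]V_eq_cv; last by lia.
  have E : cv_set U = -1 by lia.
  by have -> : cv_set (U :\ i) = 3; lia.
Qed.

(** For positive [cv_set U] the rest has its controlled value. Otherwise [V (U :\ j)] lies between 0
    and 3: if odd, the cost is 2 and only [V U = 0] could be better; if even and nonzero, it is 2,
    and the cost 1 is least by parity. *)
Lemma open_3chain_optimal U j k :
  j \in U -> c j = Chain 3 -> k \in U -> c k = Chain 3 -> k != j ->
  (forall i, i \in U -> c i = Loop 4 ->
     [/\ cv_set (U :\ i) <> 4, cv_set (U :\ j) <> 4 & cv_set (U :\ i :\ j) <> 4]) ->
  open_cost (c j) (V (U :\ j)) = V U.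
Proof.
move=> jU cj kU ck kj no4.
have kUj : k \in U :\ j by rewrite !inE kj.
have cvj := cv_open_3chain jU cj kU ck kj.
have := V_le jU; rewrite cj /= => VU.
have U0 := V_ge0 U; have Uj0 := V_ge0 (U :\ j).
have [q qE] := V_cv_parity U; have [q' qE'] := V_cv_parity (U :\ j).
have [lt2|ge2] := ltP (cv_set U) 2; last first.
  by rewrite [V U]V_eq_cv // V_eq_cv cvj; lia.
have [E1|le0] : cv_set U = 1 \/ cv_set U <= 0 by lia.
  by move: VU; rewrite [V (U :\ j)]V_eq_cv cvj E1 //; lia.
have V3 : V (U :\ j) <= 3.
  have [|_] := @V_le4 (U :\ j); first by rewrite cvj; lia.
  by apply; apply: has_compT kUj _; rewrite ck.
have neU : V U <> 0.
  move=> VU0; have /V_eq0/(_ VU0)[i [iU ci Vi]] : U != set0 by apply/set0Pn; exists j.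
  have ki : k != i by apply/eqP => E; rewrite -E ck in ci.
  have [cvi _] := cv_open_4loop iU ci kU ck.
  have [+ _ _] := no4 i iU ci; apply.
  by apply: (@V_eq4 _ k); rewrite // ?inE ?ki //; lia.
(* Strictness gives the rest after both openings a controlled value of at most [cv_set U + 5 <= 4].
   At [cv_set U = 0], parity already excludes the value 0. *)
have neUj : cv_set U < 0 -> V (U :\ j) <> 0.
  move=> lt0 VU0; have /V_eq0/(_ VU0)[i [iUj ci Vi]] : U :\ j != set0 by apply/set0Pn; exists k.
  have ki : k != i by apply/eqP => E; rewrite -E ck in ci.
  have [cvi _] := cv_open_4loop iUj ci kUj ck.
  have iU : i \in U by move: iUj; rewrite inE => /andP[].
  have [_ _] := no4 i iU ci; apply.
  have -> : U :\ i :\ j = U :\ j :\ i by rewrite !setDDl setUC.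
  by apply: (@V_eq4 _ k); rewrite // ?inE ?ki ?kj //; lia.
have [/neUj|E0] : cv_set U < 0 \/ cv_set U = 0 by lia.
  by lia.
by lia.
Qed.

End Endgame.

(** * From positions of an endgame to the recursion on sets of components *)

Definition handout_size (z : component) : nat :=
  match z with Chain _ => 4 | Loop _ => 8 end.

Lemma component_strand z : simple_loony_component z ->
  strand (component_game z) (handout_size z).
Proof.
case: z => n /=; first exact: chain_strand.
by case/andP=> n4 _; apply: loop_strand.
Qed.

Lemma open_costE z x : open_cost z x =
  #|box (component_game z)|%:Z + Num.max (- x) (x - (handout_size z)%:Z).
Proof. by case: z => n; rewrite /= card_ord. Qed.

Lemma perm_cv s t : perm_eq s t -> cv s = cv t.
Proof.
move=> st; rewrite /cv /fcv (perm_big _ st) /tb !(perm_has _ st); congr (_ + _).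
by rewrite -!size_eq0 (perm_size st).
Qed.

Section Components.
Variables (I : finType) (c : I -> component).
Implicit Types U : {set I}.

Definition comps U : seq component := [seq c i | i <- enum U].

Lemma has_comps p U : has p (comps U) = has_comp c p U.
Proof.
rewrite has_map; apply/hasP/exists_inP => [[i]|[i iU pi]].
  by rewrite mem_enum => iU pi; exists i.
by exists i; rewrite ?mem_enum.
Qed.

Lemma cv_comps U : cv (comps U) = cv_set c U.
Proof.
rewrite /cv /cv_set /fcv big_map big_enum; congr (_ + _).
rewrite /tb /tb_set !has_comps.
have -> : (comps U == [::]) = (U == set0).
  by rewrite -size_eq0 size_map -cardE cards_eq0.
rewrite (has_comp_eq0 c); have := @long_is_chain _ c U.
by case: (has_comp _ is_long_chain _); case: (has_comp _ is_loop _);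
  case: (has_comp _ is_chain _) => //= /(_ isT).
Qed.

Lemma comps_setD1 U i : i \in U -> perm_eq (comps U) (c i :: comps (U :\ i)).
Proof.
move=> iU; rewrite -[c i :: _]/(map c (i :: enum (U :\ i))); apply: perm_map.
apply: uniq_perm => [||j]; first exact: enum_uniq.
  by rewrite /= enum_uniq mem_enum !inE eqxx.
by rewrite inE !mem_enum !inE; case: eqVneq => [->|].
Qed.

Lemma mem_compsP U z : reflect (exists2 i, i \in U & c i = z) (z \in comps U).
Proof.
apply: (iffP mapP) => [[i iU ->]|[i iU <-]]; exists i => //; by rewrite mem_enum in iU *.
Qed.

End Components.

Section Opening.
Variable s : seq component.
Hypothesis s_loony : simple_loony s.

Local Notation c := (tnth (in_tuple s)).
Local Notation F := (fun i : 'I_(size s) => component_game (c i)).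

Definition value_of (U : {set 'I_(size s)}) : int := value (lines F U).

Lemma tnth_loony i : simple_loony_component (c i).
Proof. by move/allP: s_loony; apply; apply: mem_tnth. Qed.

Lemma value_open (U : {set 'I_(size s)}) (m : line (endgame s)) : tag m \in U ->
  move_value (lines F U) m = open_cost (c (tag m)) (value_of (U :\ tag m)).
Proof.
move=> mU; rewrite open_costE.
exact: (open_value (fun i => component_strand (tnth_loony i))).
Qed.

Lemma value_of0 : value_of set0 = 0.
Proof.
rewrite /value_of (_ : lines F set0 = set0) ?value0 //.
by apply/setP=> m; rewrite !inE.
Qed.

Lemma exists_line i : exists m : line (endgame s), tag m = i.
Proof.
have /card_gt0P[x _] := strand_line (component_strand (tnth_loony i)).
by exists (Tagged (fun i => line (F i)) x).
Qed.

Lemma value_of_le (U : {set 'I_(size s)}) i : i \in U ->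
  value_of U <= open_cost (c i) (value_of (U :\ i)).
Proof.
have [m <-] := exists_line i => mU; rewrite -value_open //.
by apply: value_le; rewrite inE.
Qed.

Lemma value_of_attained (U : {set 'I_(size s)}) : U != set0 ->
  exists2 i, i \in U & value_of U = open_cost (c i) (value_of (U :\ i)).
Proof.
case/set0Pn=> i; have [m <-] := exists_line i => mU.
have : lines F U != set0 by apply/set0Pn; exists m; rewrite inE.
case/value_attained=> m'; rewrite inE => m'U vm'; exists (tag m') => //.
by rewrite -value_open.
Qed.

Lemma optimal_open (m : line (endgame s)) :
  open_cost (opened m) (value_of (setT :\ tag m)) = value_of setT -> optimal m.
Proof.
rewrite /optimal (_ : [set: line (endgame s)] = lines F setT).
  by rewrite value_open // inE.
by apply/setP=> l; rewrite !inE.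
Qed.

Lemma comps_setT : comps c setT = s.
Proof. by rewrite /comps enum_setT -enumT map_tnth_enum. Qed.

Lemma other_3chain j : (2 <= count_mem (Chain 3) s)%N -> c j = Chain 3 ->
  exists2 k, c k = Chain 3 & k != j.
Proof.
rewrite -{1}comps_setT (permP (comps_setD1 c (in_setT j))) /= => + cj.
rewrite cj eqxx ltnS -has_count has_pred1 => /mem_compsP[k].
by rewrite !inE andbT => kj ck; exists k.
Qed.

(** Cancelling the 3-chain and the 4-loop shows that [H] is determined up to permutation, so [i] and
    [j] can be any such components. *)
Lemma four_loop_caseP i j : c i = Loop 4 -> c j = Chain 3 ->
  four_loop_case s <->
  [\/ cv_set c (setT :\ i) = 4, cv_set c (setT :\ j) = 4 |
      cv_set c (setT :\ i :\ j) = 4].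
Proof.
move=> ci cj; have ji : j != i by apply/eqP => E; rewrite -E cj in ci.
pose H0 := comps c (setT :\ i :\ j).
have pi : perm_eq (comps c (setT :\ i)) (H0 ++ [:: Chain 3]).
  by rewrite perm_sym perm_catC -cj perm_sym; apply: comps_setD1; rewrite !inE ji.
have pj : perm_eq (comps c (setT :\ j)) (H0 ++ [:: Loop 4]).
  rewrite perm_sym perm_catC -ci perm_sym /H0 (_ : setT :\ i :\ j = setT :\ j :\ i).
    by apply: comps_setD1; rewrite !inE eq_sym ji.
  by rewrite !setDDl setUC.
have ps : perm_eq s (H0 ++ [:: Chain 3; Loop 4]).
  rewrite -{1}comps_setT (permPl (comps_setD1 c (in_setT i))) ci.
  rewrite -[[:: _; _]]/([:: Chain 3] ++ [:: Loop 4]) catA perm_sym perm_catC /=.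
  by rewrite perm_cons perm_sym.
rewrite -!cv_comps (perm_cv pi) (perm_cv pj); split; last by exists H0.
case=> H psH; suff pH : perm_eq H H0.
  have catE t : cv (H ++ t) = cv (H0 ++ t) by apply: perm_cv; rewrite perm_cat2r.
  by rewrite !catE (perm_cv pH).
by move: ps; rewrite (permPl psH) perm_cat2r.
Qed.

End Opening.

Theorem theorem29 (s : seq component) (s_loony : simple_loony s)
    (two_3chains : (2 <= count_mem (Chain 3) s)%N) :
  (four_loop_case s ->
     forall m : line (endgame s), opened m = Loop 4 -> optimal m) /\
  (~ four_loop_case s ->
     forall m : line (endgame s), opened m = Chain 3 -> optimal m).
Proof.
have c3 := tnth_loony s_loony.
have vle := value_of_le s_loony; have vatt := value_of_attained s_loony.
split=> [H4 m ci|H4 m cj]; apply: (optimal_open s_loony).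
  have [j _ cj] : exists2 j, j \in setT & tnth (in_tuple s) j = Chain 3.
    by apply/mem_compsP; rewrite comps_setT -has_pred1 has_count; apply: ltnW.
  have [k ck kj] := other_3chain two_3chains cj.
  apply: (open_4loop_optimal c3 (@value_of0 s) vle vatt _ ci _ cj _ ck kj);
    rewrite ?in_setT //.
  exact/(four_loop_caseP ci cj).
have [k ck kj] := other_3chain two_3chains cj.
apply: (open_3chain_optimal c3 (@value_of0 s) vle vatt _ cj _ ck kj);
  rewrite ?in_setT // => i _ ci.
have no := contra_not (proj2 (four_loop_caseP ci cj)) H4.
by split=> E; apply: no; [apply: Or31|apply: Or32|apply: Or33].
Qed.
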